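(* Let $G$ be a finitely generated group, $N\trianglelefteq G$ a finitely generated normal subgroup, $A$ a finite alphabet, $X\subseteq \mathrm{Fix}_A(N)$ a $G$-SFT, and $\rho^*(X)\subseteq A^{G/N}$ its push-forward, for any section $\rho:G/N\to G$. Then $$\mathrm{stab}(\rho^*(X))=\mathrm{stab}(X)/N:=\{K/N : K\in\mathrm{stab}(X)\}.$$ In particular, if a family $\mathcal G$ of subgroups of $G$ is realizable in $G$ and $N\subseteq\bigcap_{H\in\mathcal G}H$, then $\mathcal G/N=\{K/N : K\in\mathcal G\}$ is realizable in $G/N$.
   Context: Let $K$ be a group and $A$ a non-empty finite set. $K$ acts on $A^K$ by $(g\cdot x)(h)=x(g^{-1}h)$. A pattern is a map $p:F\to A$ with $F\subset K$ finite; it appears in $x\in A^K$ if there is $g\in K$ with $p(h)=x(gh)$ for all $h\in F$. A subset $X\subseteq A^K$ is a $K$-SFT if it consists of exactly those configurations in which no pattern of some finite set of patterns appears. For $x\in A^K$, $\mathrm{stab}(x)=\{g\in K: g\cdot x=x\}$, and $\mathrm{stab}(X)=\{\mathrm{stab}(x): x\in X\}$. A family $\mathcal G$ of subgroups of $K$ is realizable in $K$ if there exist a finite alphabet $A$ and a non-empty $K$-SFT $X\subseteq A^K$ with $\mathrm{stab}(X)=\mathcal G$. $\mathrm{Fix}_A(N)=\{x\in A^G : n\cdot x=x\ \text{for all } n\in N\}$. Let $\pi:G\to G/N$ be the quotient map; a section is a map (not necessarily a homomorphism) $\rho:G/N\to G$ with $\pi\circ\rho=\mathrm{id}$. The push-forward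 of $X\subseteq\mathrm{Fix}_A(N)$ is $\rho^*(X)=\{x\circ\rho\in A^{G/N} : x\in X\}$ (it does not depend on $\rho$). *)

(* Defs.v *)
From HB Require Import structures.
From mathcomp Require Import all_boot.
From mathcomp Require Import finmap boolp classical_sets.

Set Implicit Arguments.
Unset Strict Implicit.
Unset Printing Implicit Defensive.

Local Open Scope group_scope.
Local Open Scope classical_set_scope.
Local Open Scope quotient_scope.

Definition is_subgroup (K : groupType) (H : set K) : Prop :=
  H 1 /\ forall x y, H x -> H y -> H (x / y).

Definition finitely_generated (K : groupType) (H : set K) : Prop :=
  exists S : {fset K}, H = smallest (@is_subgroup K) [set` S].

Record normalSubgroup (G : groupType) := NormalSubgroup {
  normal_set :> set G;
  normal_subgroup : is_subgroup normal_set;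
  normal_conj : forall n g, normal_set n -> normal_set (n ^ g) }.

Section Quotient.
Variables (G : groupType) (N : normalSubgroup G).

Lemma normal1 : normal_set N 1. Proof. by case: (normal_subgroup N). Qed.

Lemma normalV x : normal_set N x -> normal_set N x^-1.
Proof.
by move=> Nx; rewrite -[x^-1]mul1g; apply: (normal_subgroup N).2 => //; apply: normal1.
Qed.

Lemma normalM x y : normal_set N x -> normal_set N y -> normal_set N (x * y).
Proof.
by move=> Nx Ny; rewrite -[y]invgK; apply: (normal_subgroup N).2 => //; apply: normalV.
Qed.

Definition coset_rel (x y : G) : bool := `[< normal_set N (x^-1 * y) >].

Lemma coset_rel_refl : reflexive coset_rel.
Proof. by move=> x; apply/asboolP; rewrite mulVg; apply: normal1. Qed.

Lemma coset_rel_sym : symmetric coset_rel.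
Proof.
suff sym x y : coset_rel x y -> coset_rel y x.
  by move=> x y; apply/idP/idP; apply: sym.
by move=> /asboolP/normalV; rewrite invgM invgK => Nyx; apply/asboolP.
Qed.

Lemma coset_rel_trans : transitive coset_rel.
Proof.
move=> y x z /asboolP Nxy /asboolP Nyz; apply/asboolP.
by have := normalM Nxy Nyz; rewrite mulgA mulgK.
Qed.

Canonical coset_equiv :=
  EquivRel coset_rel coset_rel_refl coset_rel_sym coset_rel_trans.

Definition quot := {eq_quot coset_equiv}.
HB.instance Definition _ := Choice.on quot.
HB.instance Definition _ := EqQuotient.on quot.

Definition quot_proj (x : G) : quot := \pi_quot x.

Lemma quot_projP x y : quot_proj x = quot_proj y <-> normal_set N (x^-1 * y).
Proof.
split; first by move=> /eqquotP/asboolP.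
by move=> Nxy; apply/eqquotP/asboolP.
Qed.

Lemma quot_projK (q : quot) : quot_proj (repr q) = q.
Proof. exact: reprK. Qed.

Definition quot_one : quot := quot_proj 1.
Definition quot_mul (q r : quot) : quot := quot_proj (repr q * repr r).
Definition quot_inv (q : quot) : quot := quot_proj (repr q)^-1.

Lemma quot_mulE x y : quot_mul (quot_proj x) (quot_proj y) = quot_proj (x * y).
Proof.
have [] : normal_set N ((repr (quot_proj x))^-1 * x) /\ normal_set N ((repr (quot_proj y))^-1 * y).
  by split; apply/quot_projP; rewrite quot_projK.
rewrite /quot_mul; move: (repr (quot_proj x)) (repr (quot_proj y)) => x' y' Nx Ny.
apply/quot_projP.
have := normalM (normal_conj y' Nx) Ny.
by rewrite /conjg invgM !mulgA mulgK.
Qed.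

Lemma quot_invE x : quot_inv (quot_proj x) = quot_proj x^-1.
Proof.
have : normal_set N ((repr (quot_proj x))^-1 * x) by apply/quot_projP; rewrite quot_projK.
rewrite /quot_inv; move: (repr (quot_proj x)) => x'.
move=> /normalV /(normal_conj x'^-1) Nx; apply/quot_projP.
by move: Nx; rewrite /conjg invgM !invgK !mulgA mulgK.
Qed.

Lemma quot_mulA : associative quot_mul.
Proof.
move=> q r s; rewrite -(quot_projK q) -(quot_projK r) -(quot_projK s).
by rewrite !quot_mulE mulgA.
Qed.

Lemma quot_mul1 : left_id quot_one quot_mul.
Proof. by move=> q; rewrite -(quot_projK q) quot_mulE mul1g. Qed.

Lemma quot_mulr1 : right_id quot_one quot_mul.
Proof. by move=> q; rewrite -(quot_projK q) quot_mulE mulg1. Qed.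

Lemma quot_mulV : left_inverse quot_one quot_inv quot_mul.
Proof. by move=> q; rewrite -(quot_projK q) quot_invE quot_mulE mulVg. Qed.

Lemma quot_mulrV : right_inverse quot_one quot_inv quot_mul.
Proof. by move=> q; rewrite -(quot_projK q) quot_invE quot_mulE mulgV. Qed.

HB.instance Definition _ := isGroup.Build quot
  quot_mulA quot_mul1 quot_mulr1 quot_mulV quot_mulrV.

Lemma quot_projM : {morph quot_proj : x y / x * y}.
Proof. by move=> x y; rewrite -quot_mulE. Qed.

End Quotient.

Definition quot_set (G : groupType) (N : normalSubgroup G) (K : set G) :
  set (quot N) := @quot_proj G N @` K.
Arguments quot_set {G} N K.

Definition is_section (G : groupType) (N : normalSubgroup G)
  (rho : quot N -> G) : Prop := cancel rho (@quot_proj G N).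

Section Subshifts.
Variables (K : groupType) (A : finType).

Definition shift (g : K) (x : K -> A) : K -> A := fun h => x (g^-1 * h).

(* A finite map [p : {fmap K -> A}] is a function on its finite domain [domf p],
   i.e. a pattern; an element [h] of [domf p] coerces to [K] by [val]. *)
Definition appears (p : {fmap K -> A}) (x : K -> A) : Prop :=
  exists g : K, forall h : domf p, p h = x (g * val h).

Definition is_SFT (X : set (K -> A)) : Prop :=
  exists P : {fset {fmap K -> A}},
    X = [set x | forall p, p \in P -> ~ appears p x].

Definition stab (x : K -> A) : set K := [set g | shift g x = x].

Definition stab_family (X : set (K -> A)) : set (set K) := stab @` X.

Definition Fix (N : set K) : set (K -> A) :=
  [set x | forall n, N n -> shift n x = x].

End Subshifts.

Arguments Fix {K} A N.

Definition pushforward (G : groupType) (N : normalSubgroup G) (A : finType)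
  (rho : quot N -> G) (X : set (G -> A)) : set (quot N -> A) :=
  [set x \o rho | x in X].

Definition realizable (K : groupType) (F : set (set K)) : Prop :=
  exists (A : finType) (X : set (K -> A)),
    [/\ (0 < #|A|)%N, X !=set0, is_SFT X & stab_family X = F].

(* Main.v *)
Require Import Defs.
From mathcomp Require Import all_boot.
From mathcomp Require Import finmap boolp classical_sets.

(** Write [pi : G -> G/N] for the quotient map. Since [N] is normal, a
configuration fixed by the left translations by [N] is also invariant under
right multiplication by [N], so it is constant on cosets: it is [y \o pi] for
a unique [y], namely its push-forward [x \o rho] along any section
([Fix_factor]). Thus [X] contained in [Fix A N] is identified with
[[set y | X (y \o pi)]] ([pushforwardE]).

Composition with [pi] intertwines the shifts by [g] and by [pi g]
([shift_proj]) and is injective because [pi] is onto. Hence [pi g] fixes [y]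
exactly when [g] fixes [y \o pi], which gives the equality of stabilizers
([stab_section]).

For realizability it remains to see that the push-forward is an SFT
([SFT_proj]). A pattern [p] that is not constant on the fibres of [pi] never
appears in any [y \o pi]; a pattern which is constant on them descends to a
pattern on the image of its support, and it appears in [y \o pi] exactly when
the descended pattern appears in [y] ([appears_proj]). So finitely many
forbidden patterns over [G] translate into finitely many over [G/N]. *)

Local Open Scope classical_set_scope.

Section PushForward.
Local Open Scope group_scope.
Variables (G : groupType) (N : normalSubgroup G) (A : finType).
Local Notation pi := (@quot_proj G N).

Lemma quot_projV (g : G) : pi g^-1 = (pi g)^-1.
Proof. by rewrite -quot_invE. Qed.

Lemma comp_proj_inj (y z : quot N -> A) : y \o pi = z \o pi -> y = z.
Proof.
move=> yz; apply/funext => q; rewrite -(quot_projK q).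
exact: (congr1 (fun f : G -> A => f (repr q)) yz).
Qed.

Lemma shift_proj (g : G) (y : quot N -> A) :
  shift g (y \o pi) = shift (pi g) y \o pi.
Proof.
by apply/funext => h; rewrite /shift /= quot_projM quot_projV.
Qed.

Lemma Fix_proj_eq (x : G -> A) (g h : G) :
  Fix A N x -> pi g = pi h -> x g = x h.
Proof.
move=> fx /quot_projP Ngh.
(* [h = m * g] where [m] is the conjugate of [g^-1 * h] by [g^-1]: normality
   turns the right coset action into the left one, which [x] absorbs. *)
have /fx xm := @normal_conj _ N _ g^-1 Ngh.
rewrite -[in RHS]xm /shift; congr x.
by rewrite /conjg !invgM !invgK !mulgA mulgK mulgVK.
Qed.

Lemma Fix_factor (x : G -> A) (rho : quot N -> G) :
  Fix A N x -> is_section rho -> (x \o rho) \o pi = x.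
Proof. by move=> fx rhoK; apply/funext => g; apply: (Fix_proj_eq _ _ g fx (rhoK _)). Qed.

Lemma pushforwardE (X : set (G -> A)) (rho : quot N -> G) :
  X `<=` Fix A N -> is_section rho ->
  pushforward rho X = [set y : quot N -> A | X (y \o pi)].
Proof.
move=> XN rhoK; apply/seteqP; split=> [_ [x Xx <-] /= | y /= Xy].
  by rewrite Fix_factor //; apply: XN.
by exists (y \o pi) => //; apply/funext => q /=; rewrite rhoK.
Qed.

Lemma stab_proj (g : G) (y : quot N -> A) : stab y (pi g) <-> stab (y \o pi) g.
Proof.
rewrite /stab /= shift_proj; split=> [-> // | ].
exact: comp_proj_inj.
Qed.

Lemma stab_section (x : G -> A) (rho : quot N -> G) :
  Fix A N x -> is_section rho -> stab (x \o rho) = quot_set N (stab x).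
Proof.
move=> fx rhoK; have xE := Fix_factor _ _ fx rhoK.
apply/seteqP; split=> [q | _ [g gx <-]].
  rewrite -(quot_projK q) => /stab_proj; rewrite xE => gx.
  by exists (repr q).
by apply/stab_proj; rewrite xE.
Qed.

(** At most one pattern is needed on the quotient side: none when [p] separates
two points of a fibre of [pi], the descended pattern otherwise. *)
Lemma appears_proj (p : {fmap G -> A}) :
  exists P : {fset {fmap quot N -> A}}, forall y : quot N -> A,
    appears p (y \o pi) <-> exists2 q, q \in P & appears q y.
Proof.
have [[z pz]|nz] :=
  pselect (exists z : quot N -> A, forall h : domf p, p h = z (pi (val h))).
- (* Restricting a total extension [z] of the descended pattern avoids choosing
     a preimage in [domf p] for each point of the new support. *)
  pose q : {fmap quot N -> A} := [fmap c : [fset pi h | h in domf p]%fset => z (val c)].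
  exists [fset q]%fset => y; split=> [[g yp] | [_ /fset1P-> [c yq]]].
    exists q; first exact/fset1P.
    exists (pi g) => -[c cq]; rewrite ffunE /=.
    have /imfsetP[h /= hp ->] := cq.
    by rewrite -quot_projM -(pz [` hp]%fset) yp.
  exists (repr c) => -[h hp].
  have hq : pi h \in domf q by apply/imfsetP; exists h.
  have := yq [` hq]%fset; rewrite ffunE /= => zq.
  by rewrite pz /= zq quot_projM quot_projK.
- exists fset0 => y; split=> [[g yp] | [q]]; last by rewrite inE.
  case: nz; exists (fun c => y (pi g * c)) => h.
  by rewrite yp /= quot_projM.
Qed.

Lemma SFT_proj (X : set (G -> A)) :
  is_SFT X -> is_SFT [set y : quot N -> A | X (y \o pi)].
Proof.
case=> P ->; have [D DP] := choice appears_proj.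
exists (\bigcup_(p <- P) D p)%fset; apply/seteqP; split=> y /= Xy.
  move=> q /bigfcupP[p /andP[pP _] qp] yq.
  by apply: (Xy p pP); apply/DP; exists q.
move=> p pP /DP[q qp]; apply: Xy.
by apply/bigfcupP; exists p => //; rewrite pP.
Qed.

Lemma stab_family_pushforward (X : set (G -> A)) (rho : quot N -> G) :
  X `<=` Fix A N -> is_section rho ->
  stab_family (pushforward rho X) = [set quot_set N K | K in stab_family X].
Proof.
move=> XN rhoK; rewrite [LHS]image_comp [RHS]image_comp.
by apply: eq_imagel => x /XN fx /=; apply: stab_section.
Qed.

End PushForward.

Theorem proposition4p10 (G : groupType) (N : normalSubgroup G)
    (fgG : finitely_generated [set: G]) (fgN : finitely_generated N) :
  (forall (A : finType) (X : set (G -> A)) (rho : quot N -> G),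
      (0 < #|A|)%N -> X `<=` Fix A N -> is_SFT X -> is_section rho ->
      stab_family (pushforward rho X) = [set quot_set N K | K in stab_family X])
  /\
  (forall F : set (set G),
      (forall H, F H -> is_subgroup H) ->
      realizable F ->
      N `<=` \bigcap_(H in F) H ->
      realizable [set quot_set N K | K in F]).
Proof.
split=> [A X rho _ XN _ rhoK | F _ [A [X [A0 [x Xx] sX <-]]] NF].
  exact: stab_family_pushforward.
have XN : X `<=` Fix A N.
  by move=> z Xz n /NF /(_ (stab z)); apply; exists z.
have reprP : is_section (repr : quot N -> G) := @quot_projK G N.
exists A, (pushforward (repr : quot N -> G) X); split=> //.
- by exists (x \o (repr : quot N -> G)), x.
- by rewrite pushforwardE //; apply: SFT_proj.
- exact: stab_family_pushforward.
Qed.
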